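(* Let $(\Omega,\mu)$ be a $\sigma$-finite measure space and let $f,g\in L^0(\Omega;\mathbf{F}^n)$. The following are equivalent: (i) $\mathcal{K}(g)(x)\subseteq\mathcal{K}(f)(x)$ for a.e. $x\in\Omega$; (ii) $g(x)\in\mathcal{K}(f)(x)$ for a.e. $x\in\Omega$; (iii) for a.e. $x\in\Omega$, $|g(x)\cdot u|\leq|f(x)\cdot u|$ for all $u\in\mathbf{F}^n$; (iv) for a.e. $x\in\Omega$, $|Ag(x)|\leq|Af(x)|$ for all $A\in\mathbf{F}^{n\times n}$; (v) $g=hf$ for some $h\in L^\infty(\Omega)$ with $\|h\|_{L^\infty(\Omega)}\leq 1$.
   Context: $n\ge1$ is a fixed integer, $\mathbf{F}$ is $\mathbf{R}$ or $\mathbf{C}$, $u\cdot v=\sum_{k=1}^n u_k\overline{v_k}$ and $|u|=|u\cdot u|^{1/2}$ on $\mathbf{F}^n$. $L^0(\Omega;\mathbf{F}^n)$ is the space of measurable functions $\Omega\to\mathbf{F}^n$ (modulo a.e. equality). $\mathcal{K}$ is the collection of non-empty closed convex sets $K\subseteq\mathbf{F}^n$ that are symmetric ($\lambda u\in K$ whenever $u\in K$, $\lambda\in\mathbf{F}$, $|\lambda|=1$). For $u\in\mathbf{F}^n$, $\mathcal{K}(u)$ is the smallest set in $\mathcal{K}$ containing $u$, which equals $\{\lambda u:\lambda\in\mathbf{F},|\lambda|\le1\}$, and $\mathcal{K}(f)(x):=\mathcal{K}(f(x))$. $L^\infty(\Omega)$ consists of $\mathbf{F}$-valued functions. *)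

(* Defs.v *)
From HB Require Import structures.
From mathcomp Require Import all_boot all_order all_algebra.
From mathcomp Require Import all_classical all_reals all_analysis.
From mathcomp Require Import complex.

Set Implicit Arguments.
Unset Strict Implicit.
Unset Printing Implicit Defensive.

Import Order.TTheory GRing.Theory Num.Theory.
Import numFieldNormedType.Exports.

Local Open Scope classical_set_scope.
Local Open Scope ring_scope.
Local Open Scope complex_scope.

(* [scalarF R k] is the scalar field F: the reals R or the complex numbers R[i].
   It is only exposed as a numFieldType, so that the norm, the topology and the
   module structure on ['cV[scalarF R k]_n] are the generic library ones. *)
Variant scalar_kind := RealScalars | ComplexScalars.

Definition scalarF (R : realType) (k : scalar_kind) : numFieldType :=
  match k with RealScalars => R | ComplexScalars => R[i] end.

Definition sconj (R : realType) (k : scalar_kind) :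
    scalarF R k -> scalarF R k :=
  match k with
  | RealScalars => fun x : R => x
  | ComplexScalars => fun z : R[i] => z^*
  end.

(* The library norm [`|z|] of a numFieldType lives in the field itself;
   [sabs z] is the same modulus as an element of R. *)
Definition sabs (R : realType) (k : scalar_kind) : scalarF R k -> R :=
  match k with
  | RealScalars => fun x : R => `|x|
  | ComplexScalars => fun z : R[i] => complex.Re `|z|
  end.

Definition dotv (R : realType) (k : scalar_kind) (n : nat)
    (u v : 'cV[scalarF R k]_n) : scalarF R k :=
  \sum_(i < n) u i 0 * sconj (v i 0).

(* Not the library norm of a matrix, which is the sup norm. *)
Definition enorm (R : realType) (k : scalar_kind) (n : nat)
    (u : 'cV[scalarF R k]_n) : R :=
  Num.sqrt (sabs (dotv u u)).

Definition borel_fun d (T : measurableType d) (S : ptopologicalType)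
    (f : T -> S) : Prop :=
  measurable_fun [set: T] (f : T -> g_sigma_algebraType (@open S)).

(* The coefficients in [convex_set] range over [0, 1] in [scalarF R k]; for the
   order of R[i] this interval only contains real numbers. *)
Definition calK (R : realType) (k : scalar_kind) (n : nat) :
    set (set 'cV[scalarF R k]_n) :=
  [set K | [/\ K !=set0, closed K, @convex_set (scalarF R k) 'cV_n K &
    forall (lam : scalarF R k) (u : 'cV_n), K u -> `|lam| = 1 -> K (lam *: u)]].

Definition hullK (R : realType) (k : scalar_kind) (n : nat)
    (u : 'cV[scalarF R k]_n) : set 'cV[scalarF R k]_n :=
  smallest (@calK R k n) [set u].

Lemma calK_hullK (R : realType) (k : scalar_kind) (n : nat)
  (u : 'cV[scalarF R k]_n) : calK (hullK u).
Proof.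
split.
- by exists u => K [_]; apply.
- by apply: closed_bigI => K [[]].
- move=> x y l; rewrite !inE => hx hy K cK; have [[_ _ cv _] _] := cK.
  have := cv x y l; rewrite !inE; apply; [exact: hx|exact: hy].
- move=> l v hv l1 K cK; have [[_ _ _ s] _] := cK.
  by apply: s => //; exact: hv.
Qed.

Definition Linfty_norm (R : realType) (k : scalar_kind) d
    (T : measurableType d) (mu : {measure set T -> \bar R})
    (h : T -> scalarF R k) : \bar R :=
  Lnorm mu +oo%E (fun x => (sabs (h x))%:E).

Definition in_Linfty (R : realType) (k : scalar_kind) d
    (T : measurableType d) (mu : {measure set T -> \bar R})
    (h : T -> scalarF R k) : Prop :=
  borel_fun h /\ (Linfty_norm mu h < +oo)%E.

(* Main.v *)
Require Import Defs.
From HB Require Import structures.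
From mathcomp Require Import all_boot all_order all_algebra.
From mathcomp Require Import all_classical all_reals all_analysis.
From mathcomp Require Import ess_sup_inf complex ring.

Set Implicit Arguments.
Unset Strict Implicit.
Unset Printing Implicit Defensive.

Import Order.TTheory GRing.Theory Num.Theory.
Import numFieldNormedType.Exports.

Local Open Scope classical_set_scope.
Local Open Scope ring_scope.

(** Pointwise, everything reduces to linear algebra in F^n.  The set of vectors
    whose inner products are dominated by those of f(x) is closed, convex and
    symmetric, hence it contains K(f(x)): this takes (ii) to (iii) without
    describing K(f(x)), and so without any compactness argument.  The entries
    of A v are inner products of v with conjugated rows of A, which takes (iii)
    to (iv).  Conversely, matrices with a single nonzero row turn (iv) back
    into domination of all linear functionals; a vector g whose functionals are
    dominated by those of f is killed by every functional that kills f, so it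
    is a multiple of f, and comparing one nonzero coordinate bounds the scalar
    by 1 ([scale_of_dominated]).  Finally, a symmetric convex set is stable
    under scalars of modulus at most 1 ([calK_balanced]), which takes (v)
    back to (i).

    What remains is to choose the scalar measurably.  Where g(x) is a multiple
    of f(x), the scalar is the quotient of their coordinates at the first index
    where f(x) does not vanish ([coord_ratio]).  This is a finite case
    distinction between quotients of Borel functions, and such quotients are
    Borel because F has a countable basis ([scalar_basis]). *)

(** * Linear functionals *)

Lemma closed_norm_le (K : numFieldType) (c : K) :
  closed [set z : K | `|z| <= `|c|].
Proof.
rewrite -openC openE => z /= /negP zc; rewrite /interior/=.
(* The order of K need not be total, but norms are comparable. *)
have {zc}cz : `|c| < `|z| by rewrite real_ltNge ?normr_real//; apply/negP.
apply/nbhs_ballP; exists (`|z| - `|c|); rewrite /= ?subr_gt0// => w.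
rewrite -ball_normE /= => zw; apply/negP; rewrite -real_ltNge ?normr_real//.
rewrite -(ltrD2l (`|z - w|)) (lt_le_trans (y:=`|z|))//; last first.
  by rewrite -[in leLHS](subrK w z) ler_normD.
by rewrite -ltrBrDr.
Qed.

Lemma continuous_coord_sum (K : numFieldType) n (c : 'I_n -> K) :
  continuous (fun v : 'cV[K]_n => \sum_i v i 0 * c i).
Proof.
apply: (@continuous_big K) => /=.
  exact: add_continuous.
move=> i _ v; apply: (@cvgM K _ (nbhs v)); last exact: cvg_cst.
exact: (@coord_continuous K n 1 i 0 v).
Qed.

(** If f_j <> 0, the functional v |-> f_j v_i - f_i v_j vanishes at f, hence at
    g, so g = (g_j / f_j) f; the j-th coordinate bounds this scalar. *)
Lemma scale_of_dominated (K : numFieldType) n (f g : 'cV[K]_n) :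
  (forall r : 'rV_n, `|(r *m g) 0 0| <= `|(r *m f) 0 0|) ->
  exists2 lam : K, `|lam| <= 1 & g = lam *: f.
Proof.
move=> gf.
have coord j (v : 'cV[K]_n) : (delta_mx 0 j *m v : 'M[K]_1) 0 0 = v j 0.
  by rewrite -rowE mxE.
have [f0|[j fj0]] : (forall j, f j 0 = 0) \/ exists j, f j 0 != 0.
  have [/existsP|/existsPn h] := boolP [exists j, f j 0 != 0]; first by right.
  by left=> j; apply/eqP; rewrite -[_ == _]negbK h.
- exists 0; first by rewrite normr0 ler01.
  apply/colP => j; rewrite scale0r mxE; apply/eqP.
  by have := gf (delta_mx 0 j); rewrite !coord f0 normr0 normr_le0.
exists (g j 0 / f j 0).
  by rewrite normf_div ler_pdivrMr ?normr_gt0// mul1r -!coord gf.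
apply/colP => i; rewrite mxE.
pose r : 'rV[K]_n := f j 0 *: delta_mx 0 i - f i 0 *: delta_mx 0 j.
have rE (v : 'cV[K]_n) : (r *m v) 0 0 = f j 0 * v i 0 - f i 0 * v j 0.
  by rewrite mulmxBl -!scalemxAl !mxE -!coord !mxE.
have := gf r; rewrite !rE [f i 0 * f j 0]mulrC subrr normr0 normr_le0 subr_eq0.
by move=> /eqP h; apply: (mulfI fj0); rewrite h; field.
Qed.

Lemma polar_decomposition (K : numFieldType) (z : K) :
  exists2 s : K, `|s| = 1 & z = `|z| * s.
Proof.
have [->|z0] := eqVneq z 0; first by exists 1; rewrite ?normr1// normr0 mul0r.
exists (z / `|z|); last by rewrite mulrCA mulfV ?mulr1// normr_eq0.
by rewrite normf_div normr_id mulfV// normr_eq0.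
Qed.

(** * The scalar field *)

Lemma normc_le_sum (R : rcfType) (z : R[i]) :
  `|z| <= (`|complex.Re z| + `|complex.Im z|)%:C%C.
Proof.
rewrite normc_def lecR -[leRHS]ger0_norm ?addr_ge0// -[leRHS]sqrtr_sqr.
rewrite ler_sqrt ?sqr_ge0// sqrrD !real_normK ?num_real//.
by rewrite lerD2r lerDl mulrn_wge0// mulr_ge0.
Qed.

Section Scalars.
Variables (R : realType) (k : scalar_kind).
Local Notation F := (scalarF R k).

(** Lets inequalities between moduli in R be proved with the norm of F, whose
    theory covers both kinds of scalars at once. *)
Lemma le_sabs (z w : F) : (sabs z <= sabs w) = (`|z| <= `|w|).
Proof.
case: k z w => [|] z w //.
by rewrite /sabs -lecR !RRe_real ?normr_real.
Qed.

Lemma sabs_ge0 (z : F) : 0 <= sabs z.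
Proof.
case: k z => [|] z; first exact: normr_ge0.
by rewrite /sabs -lecR RRe_real ?normr_real// normr_ge0.
Qed.

Lemma sabs1 : sabs (1 : F) = 1.
Proof.
case: k; first exact: normr1.
exact: (congr1 (@complex.Re R) (normr1 _)).
Qed.

Lemma sconjK : involutive (@sconj R k).
Proof. by case: k => [|] z //; exact: conjcK. Qed.

Lemma mul_sconj (z : F) : z * sconj z = `|z| ^+ 2.
Proof.
case: k z => [|] z; first by rewrite /= real_normK ?num_real.
exact: (esym (sqr_normc z)).
Qed.

Lemma le_enorm m n (v : 'cV[F]_m) (w : 'cV[F]_n) :
  (enorm v <= enorm w) = (\sum_i `|v i 0| ^+ 2 <= \sum_i `|w i 0| ^+ 2).
Proof.
have normE p (x : 'cV[F]_p) : `|dotv x x| = \sum_i `|x i 0| ^+ 2.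
  rewrite /dotv; under eq_bigr do rewrite mul_sconj.
  by rewrite ger0_norm// sumr_ge0// => i _; rewrite exprn_ge0.
by rewrite /enorm ler_sqrt ?sabs_ge0// le_sabs !normE.
Qed.

Lemma dotv_row n (r : 'rV[F]_n) (v : 'cV[F]_n) :
  (r *m v) 0 0 = dotv v (map_mx (@sconj R k) r^T).
Proof.
by rewrite mxE /dotv; apply: eq_bigr => i _; rewrite !mxE sconjK mulrC.
Qed.

Lemma Linfty_norm_le1 d (T : measurableType d) (mu : {measure set T -> \bar R})
    (h : T -> F) :
  (Linfty_norm mu h <= 1)%E <-> \forall x \ae mu, `|h x| <= 1.
Proof.
have abs1 x : (`|(sabs (h x))%:E| <= 1)%E = (`|h x| <= 1).
  by rewrite gee0_abs ?lee_fin ?sabs_ge0// -sabs1 le_sabs normr1.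
(* On a null space the norm is 0 by convention, and every property holds
   almost everywhere. *)
rewrite /Linfty_norm unlock; split.
  case: ifPn => [_ /ess_supP|]; first by apply: filterS => x; rewrite /= abs1.
  rewrite -leNgt measure_le0 => /eqP mu0 _.
  by exists setT; split.
move=> h1; case: ifPn => // _; apply/ess_supP.
by apply: filterS h1 => x; rewrite /= abs1.
Qed.

(** The basic sets are the balls of radius 1/(m+1) around the points with
    rational coordinates.  For both fields this only takes the density of these
    points and the existence of some 1/(m+1) below each positive element. *)
Lemma scalar_basis : exists B : rat * rat * nat -> set F, basis (range B).
Proof.
suff [c [c_dense arch]] : exists c : rat * rat -> F,
    (forall (x : F) e, 0 < e -> exists q, `|x - c q| < e) /\
    (forall e : F, 0 < e -> exists m, m.+1%:R^-1 < e).
  exists (fun p => ball (c p.1) p.2.+1%:R^-1); split.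
    by move=> _ [p _ <-]; exact: ball_open.
  move=> x U /nbhs_ballP[e /= e0 eU].
  have [m me] := arch (e / 2) (divr_gt0 e0 (ltr0Sn _ 1)).
  have m0 : 0 < m.+1%:R^-1 :> F by rewrite invr_gt0.
  have [q xq] := c_dense x _ m0.
  exists (ball (c q) m.+1%:R^-1).
    split; first by exists (q, m).
    by rewrite -ball_normE /= distrC.
  move=> y cy; apply: eU; apply: (@ball_splitr _ _ (c q)).
    by rewrite -ball_normE /= distrC (lt_trans xq).
  by apply: le_ball cy; exact: ltW.
case: k => /=.
- exists (fun p => ratr p.1); split=> [x e e0|e e0].
    have [|q] := @rat_in_itvoo R x (x + e); first by rewrite ltrDl.
    rewrite in_itv /= => /andP[q1 q2]; exists (q, 0).
    by rewrite distrC gtr0_norm ?subr_gt0// ltrBlDl.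
  have [m _ /(_ m (leqnn m))] := near_infty_natSinv_lt (PosNum e0).
  by exists m.
(* A positive element e of R[i] is real, so Re e can be used in its place. *)
exists (fun p => Complex (ratr p.1) (ratr p.2)); split=> [x e e0|e e0].
  have e0' : 0 < complex.Re e by move: e0; rewrite ltcE => /andP[].
  have rat_near (a : R) : exists q : rat, `|a - ratr q| < complex.Re e / 2.
    have [|q] := @rat_in_itvoo R a (a + complex.Re e / 2).
      by rewrite ltrDl divr_gt0.
    rewrite in_itv /= => /andP[q1 q2]; exists q.
    by rewrite distrC gtr0_norm ?subr_gt0// ltrBlDl.
  case: x => a b; have [[p ap] [q bq]] := (rat_near a, rat_near b).
  exists (p, q).
  rewrite -(RRe_real (gtr0_real e0)) (le_lt_trans (normc_le_sum _))// ltcR.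
  by rewrite [ltRHS]splitr ltrD.
have e0' : 0 < complex.Re e by move: e0; rewrite ltcE => /andP[].
have [m _ /(_ m (leqnn m)) /= me] := near_infty_natSinv_lt (PosNum e0').
exists m.
rewrite -(RRe_real (gtr0_real e0)).
rewrite -[_^-1](_ : (m.+1%:R^-1 : R)%:C%C = _) ?ltcR//.
by rewrite fmorphV rmorph_nat.
Qed.

End Scalars.

(** * Closed convex symmetric sets *)

Section ConvexSymmetric.
Variables (R : realType) (k : scalar_kind) (n : nat).
Local Notation F := (scalarF R k).
Implicit Type u f : 'cV[F]_n.

Lemma hullK_self u : hullK u u.
Proof. by move=> K [_]; apply. Qed.

(** Writing lam = t s with |s| = 1 and 0 <= t <= 1, the vector lam u is the
    convex combination of s u and - s u with weights (1 + t)/2, (1 - t)/2. *)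
Lemma calK_balanced (K : set 'cV[F]_n) u (lam : F) :
  calK K -> K u -> `|lam| <= 1 -> K (lam *: u).
Proof.
move=> [_ _ Kconv Ksym] Ku lam1; have [s s1 lamE] := polar_decomposition lam.
have t0 : 0 <= (1 + `|lam|) / 2 by rewrite divr_ge0// addr_ge0.
have t1 : (1 + `|lam|) / 2 <= 1.
  by rewrite ler_pdivrMr// mul1r -[2]/(1 + 1) lerD2l.
have := Kconv (s *: u) (- s *: u) (Itv01 t0 t1).
rewrite !inE; have Ks : K (s *: u) by exact: Ksym.
have KNs : K (- s *: u) by apply: Ksym; rewrite ?normrN.
move=> /(_ Ks KNs); congr K.
rewrite /conv/= !scalerA -scalerDl; congr (_ *: _).
rewrite [in RHS]lamE /unstable.onem mulrN -mulrBl; congr (_ * s).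
by field.
Qed.

(** Used as an upper bound for the hull of f: belonging to this set is the
    domination of inner products that the hull has to imply. *)
Lemma calK_dominated f :
  @calK R k n [set v | forall u, `|dotv v u| <= `|dotv f u|].
Proof.
have dotD (a b : F) (v w u : 'cV[F]_n) :
    dotv (a *: v + b *: w) u = a * dotv v u + b * dotv w u.
  rewrite /dotv !mulr_sumr -big_split/=; apply: eq_bigr => i _.
  by rewrite !mxE mulrDl !mulrA.
have dotZ (a : F) (v u : 'cV[F]_n) : dotv (a *: v) u = a * dotv v u.
  by rewrite /dotv mulr_sumr; apply: eq_bigr => i _; rewrite mxE mulrA.
split.
- by exists f => /=.
- rewrite (_ : mkset _ =
      \bigcap_(u in [set: 'cV[F]_n]) [set v | `|dotv v u| <= `|dotv f u|]).
    apply: closed_bigI => u _; apply: (@closed_comp _ _ (fun v => dotv v u)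
      [set z | `|z| <= `|dotv f u|]).
      by move=> v _; exact: continuous_coord_sum.
    exact: closed_norm_le.
  by apply/seteqP; split => v h u => [_|]; [exact: h|exact: (h u I)].
- move=> v w l; rewrite !inE /= => hv hw u.
  rewrite /conv/= dotD (le_trans (ler_normD _ _))// !normrM.
  rewrite -[leRHS]mul1r -[1](subrKC l%:num) mulrDl.
  by rewrite lerD// ger0_norm ?ler_wpM2l ?subr_ge0.
- by move=> lam v /= hv l1 u; rewrite dotZ normrM l1 mul1r.
Qed.

End ConvexSymmetric.

(** * Measurable choice of the scalar *)

(** As a fold, this is a finite iteration of conditional quotients, so that
    measurability follows by induction on the list of indices. *)
Definition coord_ratio (K : fieldType) n (g f : 'cV[K]_n) : K :=
  foldr (fun i q => if f i 0 != 0 then g i 0 / f i 0 else q) 0 (enum 'I_n).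

Lemma coord_ratio_scale (K : fieldType) n (lam : K) (f : 'cV[K]_n) :
  coord_ratio (lam *: f) f = if f == 0 then 0 else lam.
Proof.
have -> : (f == 0) = ~~ has (fun i => f i 0 != 0) (enum 'I_n).
  apply/eqP/hasPn => [-> i _|f0]; first by rewrite mxE eqxx.
  apply/colP => i; rewrite mxE; apply/eqP.
  by rewrite -[_ == _]negbK f0 ?mem_enum.
rewrite /coord_ratio; elim: (enum _) => //= i s ->.
by case: eqVneq => //= fi; rewrite mxE mulfK.
Qed.

Lemma open_division (K : numFieldType) (U : set K) :
  open U -> open [set p : K * K | p.2 != 0 /\ U (p.1 / p.2)].
Proof.
move=> oU; rewrite openE => -[x y] [/= y0 Uxy].
have cdiv : p.1 / p.2 @[p --> (x, y)] --> x / y.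
  apply: (@cvgM K _ (nbhs (x, y)) _ fst (fun p => p.2^-1)).
    exact: cvg_fst.
  by apply: (@cvgV K _ (nbhs (x, y)) _ snd y) => //; exact: cvg_snd.
have oN : open [set z : K | z != 0].
  rewrite (_ : mkset _ = ~` [set z : K | `|z| <= `|0 : K|]).
    by apply: closed_openC; exact: closed_norm_le.
  by apply/seteqP; split=> z /=; rewrite normr0 normr_le0 => /negP.
rewrite /interior; near=> p; split; near: p.
  have csnd : p.2 @[p --> (x, y)] --> y by exact: cvg_snd.
  exact: (csnd _ (open_nbhs_nbhs (conj oN y0))).
exact: (cdiv _ (open_nbhs_nbhs (conj oU Uxy))).
Unshelve. all: by end_near. Qed.

Section BorelFunctions.
Context d (T : measurableType d).

Lemma borel_fun_preimage (S : ptopologicalType) (a : T -> S) (U : set S) :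
  borel_fun a -> open U -> measurable (a @^-1` U).
Proof.
move=> ma oU; rewrite -[_ @^-1` _]setTI.
by apply: ma => //; exact: sub_sigma_algebra.
Qed.

Lemma borel_fun_open (S : ptopologicalType) (a : T -> S) :
  (forall U, open U -> measurable (a @^-1` U)) -> borel_fun a.
Proof.
move=> ma.
apply: (@measurability _ _ T (g_sigma_algebraType (@open S)) _ _ (@open S)) =>
  // _ [U oU <-].
by rewrite setTI; exact: ma.
Qed.

Lemma borel_fun_comp (S S' : ptopologicalType) (a : T -> S) (phi : S -> S') :
  borel_fun a -> continuous phi -> borel_fun (phi \o a).
Proof.
move=> ma /continuousP cphi; apply: borel_fun_open => U oU.
by rewrite comp_preimage; apply: borel_fun_preimage => //; exact: cphi.
Qed.

(** With countable bases, W is the union of the countably many basic rectangles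
    that it contains, and the preimage of a rectangle under (a, b) is an
    intersection of two measurable sets. *)
Lemma measurable_preimage_pair (I J : countType) (S S' : ptopologicalType)
    (B : I -> set S) (C : J -> set S') (a : T -> S) (b : T -> S')
    (W : set (S * S')) :
  basis (range B) -> basis (range C) -> borel_fun a -> borel_fun b -> open W ->
  measurable [set t | W (a t, b t)].
Proof.
move=> [oB bB] [oC bC] ma mb; rewrite openE => oW.
(* Rectangles that are not contained in W contribute the empty set. *)
pose E (p : I * J) :=
  [set t | (B p.1 `*` C p.2 `<=` W) /\ B p.1 (a t) /\ C p.2 (b t)].
rewrite (_ : mkset _ = \bigcup_p E p).
  apply: countable_bigcupT_measurable => // -[i j].
  have [BCW|nBCW] := pselect (B i `*` C j `<=` W).
    rewrite (_ : E _ = a @^-1` B i `&` b @^-1` C j).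
      apply: measurableI; apply: borel_fun_preimage => //.
        by apply: oB; exists i.
      by apply: oC; exists j.
    by apply/seteqP; split=> t => [[]|].
  by rewrite (_ : E _ = set0) // -subset0 => t [].
apply/seteqP; split=> [t /= /oW [[P Q] /= [PN QN] PQ]|].
  have [_ [[i _ <-] Ba] BP] := bB _ _ PN.
  have [_ [[j _ <-] Cb] CQ] := bC _ _ QN.
  exists (i, j) => //; split => // -[x y] [/= Bx Cy].
  by apply: PQ; split; [exact: BP|exact: CQ].
by move=> t [[i j] _ [/= + [Ba Cb]]]; apply; split.
Qed.

Variables (R : realType) (k : scalar_kind).
Local Notation F := (scalarF R k).

Lemma borel_fun_div_else (a b c : T -> F) :
  borel_fun a -> borel_fun b -> borel_fun c ->
  borel_fun (fun t => if b t != 0 then a t / b t else c t).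
Proof.
move=> ma mb mc; have [B bB] := scalar_basis R k.
have mW U : open U -> measurable [set t | b t != 0 /\ U (a t / b t)].
  move=> oU; exact: (measurable_preimage_pair bB bB ma mb (open_division oU)).
apply: borel_fun_open => U oU.
(* Taking U := setT recovers the set where b does not vanish. *)
rewrite (_ : _ @^-1` _ = [set t | b t != 0 /\ U (a t / b t)] `|`
    (c @^-1` U `\` [set t | b t != 0 /\ setT (a t / b t)])).
  apply: measurableU; first exact: mW.
  by apply: measurableD; [exact: borel_fun_preimage|apply: mW; exact: openT].
apply/seteqP; split=> t /=.
  by case: ifPn => [bt Ut|_ Uct]; [left|right; split => // -[]].
case: ifPn => [bt [[_ //]|[_ nbt]]|_ [[//]|[//]]].
by exfalso; apply: nbt.
Qed.

Lemma borel_fun_coord_ratio n (g f : T -> 'cV[F]_n) :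
  borel_fun g -> borel_fun f -> borel_fun (fun t => coord_ratio (g t) (f t)).
Proof.
move=> mg mf; rewrite /coord_ratio; elim: (enum _) => [|i s IHs] /=.
  exact: measurable_cst.
have coord (v : T -> 'cV[F]_n) : borel_fun v -> borel_fun (fun t => v t i 0).
  move=> mv; apply: (borel_fun_comp (phi := fun w : 'cV[F]_n => w i 0) mv).
  exact: (@coord_continuous F n 1 i 0).
exact: (borel_fun_div_else (coord _ mg) (coord _ mf) IHs).
Qed.

End BorelFunctions.

(** * The equivalence *)

Theorem proposition2p4 (R : realType) (k : scalar_kind) (n : nat)
    (hn : (1 <= n)%N) (d : measure_display) (T : measurableType d)
    (mu : {measure set T -> \bar R}) (hmu : sigma_finite [set: T] mu)
    (f g : T -> 'cV[scalarF R k]_n) (hf : borel_fun f) (hg : borel_fun g) :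
  [<-> (* (i) *) \forall x \ae mu, hullK (g x) `<=` hullK (f x);
       (* (ii) *) \forall x \ae mu, hullK (f x) (g x);
       (* (iii) *) \forall x \ae mu, forall u : 'cV[scalarF R k]_n,
                     sabs (dotv (g x) u) <= sabs (dotv (f x) u);
       (* (iv) *) \forall x \ae mu, forall A : 'M[scalarF R k]_n,
                    enorm (A *m g x) <= enorm (A *m f x);
       (* (v) *) exists h : T -> scalarF R k,
                   [/\ in_Linfty mu h, (Linfty_norm mu h <= 1)%E &
                       \forall x \ae mu, g x = h x *: f x]].
Proof.
tfae.
- by apply: filterS => x; apply; exact: hullK_self.
- apply: filterS => x gx u; rewrite le_sabs.
  by apply: (gx _ (conj (calK_dominated (f x)) _)) => _ ->.
- apply: filterS => x gf A; rewrite le_enorm; apply: ler_sum => i _.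
  rewrite lerXn2r ?nnegrE//.
  have rowA (v : 'cV[scalarF R k]_n) : (A *m v) i 0 = (row i A *m v) 0 0.
    by rewrite -row_mul [RHS]mxE.
  by rewrite !rowA !dotv_row -le_sabs.
- move=> gf.
  have gscale : \forall x \ae mu,
      exists2 lam : scalarF R k, `|lam| <= 1 & g x = lam *: f x.
    apply: filterS gf => x gf; apply: scale_of_dominated => r.
    (* Put r in one row of the matrix: only one entry of the image survives. *)
    pose i0 := Ordinal hn.
    have := gf (delta_mx i0 0 *m r); rewrite le_enorm.
    have sum_row (v : 'cV[scalarF R k]_n) :
        \sum_i `|(delta_mx i0 0 *m r *m v) i 0| ^+ 2 = `|(r *m v) 0 0| ^+ 2.
      have entry i : (delta_mx i0 0 *m r *m v) i 0
          = (i == i0)%:R * (r *m v) 0 0.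
        by rewrite -mulmxA mxE big_ord1 mxE andbT.
      rewrite (bigD1 i0)//= big1 ?addr0 => [|i /negbTE ni].
        by rewrite entry eqxx mul1r.
      by rewrite entry ni mul0r normr0 expr0n.
    by rewrite !sum_row ler_pXn2r ?nnegrE.
  pose h x := coord_ratio (g x) (f x).
  have h1 : (Linfty_norm mu h <= 1)%E.
    apply/Linfty_norm_le1; apply: filterS gscale => x [lam lam1 gE].
    by rewrite /h gE coord_ratio_scale; case: ifPn => // _; rewrite normr0 ler01.
  exists h; split=> //.
    split; first exact: borel_fun_coord_ratio.
    exact: le_lt_trans h1 (ltry 1).
  apply: filterS gscale => x [lam _ gE]; rewrite /h gE coord_ratio_scale.
  by case: eqVneq => // ->; rewrite !scaler0.
- move=> [h [_ /Linfty_norm_le1 h1 gE]].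
  apply: filterS2 h1 gE => x h1 gE v gv K [cK fK].
  apply: gv; split=> // _ ->; rewrite gE.
  by apply: calK_balanced => //; exact: fK.
Qed.
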